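(* Let $\Sigma=(n_1,n_2,\{(E_i,A_i,B_i,C_i)\}_{i=1}^2,\{K_1,K_2\})$ be a SISO linear switched system (LSS) with two modes and zero initial state. Let right and left interpolation points be given as in the context with $k=\ell$, and let $\mathbb{L}_i,\mathbb{L}_{s,i},V_i,W_i,\Xi_i$ ($i=1,2$) be the associated Loewner matrices, shifted Loewner matrices, data vectors and data matrices. Assume that none of the interpolation points $\lambda^{(i)}_g,\mu^{(j)}_h$ is an eigenvalue of the pencil $(\mathbb{L}_{s,1},\mathbb{L}_1)$ or of the pencil $(\mathbb{L}_{s,2},\mathbb{L}_2)$, and that $\mathbb{L}_1$ and $\mathbb{L}_2$ are invertible. Then the LSS $\hat\Sigma$ (with zero initial state) defined by $$\hat E_i=-\mathbb{L}_i,\quad \hat A_i=-\mathbb{L}_{s,i},\quad \hat B_i=V_i,\quad \hat C_i=W_i\quad(i=1,2),\qquad \hat K_1=\Xi_1,\quad \hat K_2=\Xi_2$$ matches the data of $\Sigma$ associated with the given right and left tuples. If moreover $n_1=n_2=k$, then $\hat\Sigma$ is equivalent to $\Sigma$.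
   Context: **LSS with two modes.** $\Sigma$ is given by matrices $E_q,A_q\in\mathbb{R}^{n_q\times n_q}$, $B_q\in\mathbb{R}^{n_q\times 1}$, $C_q\in\mathbb{R}^{1\times n_q}$ for $q\in\{1,2\}$ ($E_q$ may be singular), and coupling matrices $K_1\in\mathbb{R}^{n_2\times n_1}$ (switching from mode 1 to mode 2) and $K_2\in\mathbb{R}^{n_1\times n_2}$ (from mode 2 to mode 1). A reduced LSS $\hat\Sigma$ has the same structure, possibly with complex entries. Write $\Phi_q(s)=(sE_q-A_q)^{-1}$. A number $s$ is an eigenvalue of the pencil $(A,E)$ if $\det(sE-A)=0$. **Generalized transfer functions.** For a word $(q_1,\dots,q_r)$ in $\{1,2\}$ with no two consecutive symbols equal, $$H_{q_1,\dots,q_r}(s_1,\dots,s_r)=C_{q_1}\Phi_{q_1}(s_1)K_{q_2}\Phi_{q_2}(s_2)K_{q_3}\cdots K_{q_r}\Phi_{q_r}(s_r)B_{q_r}.$$ $\hat H$ denotes the analogous functions of $\hat\Sigma$. **Interpolation points.** Let $m_1,\dots,m_{k^\dagger}\ge1$ with $m_1+\dots+m_{k^\dagger}=k$ and $p_1,\dots,p_{\ell^\dagger}\ge1$ with $p_1+\dots+p_{\ell^\dagger}=\ell$. The right points are $\lambda^{(i)}_1,\dots,\lambda^{(i)}_{2m_i}\in\mathbb{C}$ ($1\le i\le k^\dagger$) and the left points are $\mu^{(j)}_1,\dots,\mu^{(j)}_{2p_j}\in\mathbb{C}$ ($1\le j\le\ell^\dagger$). It is assumed that the points with odd subscript are not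 eigenvalues of $(A_1,E_1)$ and those with even subscript are not eigenvalues of $(A_2,E_2)$. **Tuples.** With $\circledcirc$ denoting concatenation of tuples: $\boldsymbol\lambda_1^{(i)}(1)=(\lambda_1^{(i)})$, $\boldsymbol\lambda_2^{(i)}(1)=(\lambda_2^{(i)})$ and, for $1<g\le m_i$, $\boldsymbol\lambda_1^{(i)}(g)=(\lambda^{(i)}_{2g-1})\circledcirc\boldsymbol\lambda_2^{(i)}(g-1)$, $\boldsymbol\lambda_2^{(i)}(g)=(\lambda^{(i)}_{2g})\circledcirc\boldsymbol\lambda_1^{(i)}(g-1)$. Likewise $\boldsymbol\mu_1^{(j)}(1)=(\mu_1^{(j)})$, $\boldsymbol\mu_2^{(j)}(1)=(\mu_2^{(j)})$ and, for $1<h\le p_j$, $\boldsymbol\mu_1^{(j)}(h)=\boldsymbol\mu_2^{(j)}(h-1)\circledcirc(\mu^{(j)}_{2h-1})$, $\boldsymbol\mu_2^{(j)}(h)=\boldsymbol\mu_1^{(j)}(h-1)\circledcirc(\mu^{(j)}_{2h})$. **Generalized controllability matrices.** $\mathcal{R}_q=[\mathcal{R}_q^{(1)},\dots,\mathcal{R}_q^{(k^\dagger)}]\in\mathbb{C}^{n_q\times k}$, where $\mathcal{R}_q^{(i)}$ has columns $r^{(i)}_{q,1},\dots,r^{(i)}_{q,m_i}$ given by $r^{(i)}_{1,1}=\Phi_1(\lambda^{(i)}_1)B_1$, $r^{(i)}_{2,1}=\Phi_2(\lambda^{(i)}_2)B_2$, and for $g\ge2$: $r^{(i)}_{1,g}=\Phi_1(\lambda^{(i)}_{2g-1})K_2r^{(i)}_{2,g-1}$,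 $r^{(i)}_{2,g}=\Phi_2(\lambda^{(i)}_{2g})K_1r^{(i)}_{1,g-1}$. **Generalized observability matrices.** $\mathcal{O}_q\in\mathbb{C}^{\ell\times n_q}$ is the vertical stack of $\mathcal{O}_q^{(1)},\dots,\mathcal{O}_q^{(\ell^\dagger)}$, where $\mathcal{O}_q^{(j)}$ has rows $o^{(j)}_{q,1},\dots,o^{(j)}_{q,p_j}$ given by $o^{(j)}_{1,1}=C_1\Phi_1(\mu^{(j)}_1)$, $o^{(j)}_{2,1}=C_2\Phi_2(\mu^{(j)}_2)$, and for $h\ge2$: $o^{(j)}_{1,h}=o^{(j)}_{2,h-1}K_1\Phi_1(\mu^{(j)}_{2h-1})$, $o^{(j)}_{2,h}=o^{(j)}_{1,h-1}K_2\Phi_2(\mu^{(j)}_{2h})$. **Loewner quantities.** For $i=1,2$: $\mathbb{L}_i=-\mathcal{O}_iE_i\mathcal{R}_i$, $\mathbb{L}_{s,i}=-\mathcal{O}_iA_i\mathcal{R}_i$, $W_i=C_i\mathcal{R}_i$, $V_i=\mathcal{O}_iB_i$; and $\Xi_1=\mathcal{O}_2K_1\mathcal{R}_1$, $\Xi_2=\mathcal{O}_1K_2\mathcal{R}_2$. **Matching the data.** Let $Q^{\nu,+}(g)$ (resp. $Q^{+,\nu}(g)$) be the word of length $g$ in $\{1,2\}$ with no two consecutive equal symbols that starts (resp. ends) with $\nu$. $\hat\Sigma$ matches the data of $\Sigma$ if, for all $1\le j\le\ell^\dagger$, $1\le h\le p_j$, $1\le i\le k^\dagger$, $1\le g\le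 m_i$ and $a\in\{1,2\}$, the following hold: - $H_{Q^{+,a}(h)}(\boldsymbol\mu_a^{(j)}(h))=\hat H_{Q^{+,a}(h)}(\boldsymbol\mu_a^{(j)}(h))$; - $H_{Q^{a,+}(g)}(\boldsymbol\lambda_a^{(i)}(g))=\hat H_{Q^{a,+}(g)}(\boldsymbol\lambda_a^{(i)}(g))$; - for $(a,b)\in\{(1,2),(2,1)\}$: $H_{Q^{+,a}(h)\circledcirc Q^{b,+}(g)}(\boldsymbol\mu_a^{(j)}(h)\circledcirc\boldsymbol\lambda_b^{(i)}(g))=\hat H_{Q^{+,a}(h)\circledcirc Q^{b,+}(g)}(\boldsymbol\mu_a^{(j)}(h)\circledcirc\boldsymbol\lambda_b^{(i)}(g))$. **Equivalence.** Two LSS $\hat\Sigma$ and $\bar\Sigma$ of the same order $(n_1,n_2)$ are equivalent if there are nonsingular (complex) matrices $Z_j^L,Z_j^R$, $j=1,2$, with $\bar E_j=Z_j^L\hat E_jZ_j^R$, $\bar A_j=Z_j^L\hat A_jZ_j^R$, $\bar B_j=Z_j^L\hat B_j$, $\bar C_j=\hat C_jZ_j^R$, and $\bar K_1=Z_2^L\hat K_1Z_1^R$, $\bar K_2=Z_1^L\hat K_2Z_2^R$. *)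

(* Defs.v *)
From mathcomp Require Import all_boot all_order all_algebra.
From mathcomp Require Import reals.
From mathcomp.real_closed Require Import complex.

Set Implicit Arguments.
Unset Strict Implicit.
Unset Printing Implicit Defensive.

Import GRing.Theory.
Local Open Scope ring_scope.

Inductive mode := M1 | M2.

Definition other (q : mode) : mode := if q is M1 then M2 else M1.

(** SISO linear switched systems with two modes, of order [(n M1, n M2)] and
    zero initial state (so that no initial state is recorded).
    [lssK S q] is the coupling matrix for the switch from [q] to [other q]. *)
Record lss (F : Type) (n : mode -> nat) := Lss {
  lssE : forall q, 'M[F]_(n q);
  lssA : forall q, 'M[F]_(n q);
  lssB : forall q, 'cV[F]_(n q);
  lssC : forall q, 'rV[F]_(n q);
  lssK : forall q, 'M[F]_(n (other q), n q)
}.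

Definition map_lss (F F' : Type) (f : F -> F') (n : mode -> nat)
    (S : lss F n) : lss F' n :=
  Lss (fun q => map_mx f (lssE S q)) (fun q => map_mx f (lssA S q))
      (fun q => map_mx f (lssB S q)) (fun q => map_mx f (lssC S q))
      (fun q => map_mx f (lssK S q)).

Definition complexify (R : realType) (n : mode -> nat) (S : lss R n) :
  lss R[i] n := map_lss (real_complex R) S.

Definition cast_lss (F : Type) (n n' : mode -> nat) (e : forall q, n q = n' q)
    (S : lss F n) : lss F n' :=
  Lss (fun q => castmx (e q, e q) (lssE S q))
      (fun q => castmx (e q, e q) (lssA S q))
      (fun q => castmx (e q, erefl 1%N) (lssB S q))
      (fun q => castmx (erefl 1%N, e q) (lssC S q))
      (fun q => castmx (e (other q), e q) (lssK S q)).

Definition lss_equiv (F : fieldType) (n : mode -> nat) (S S' : lss F n) :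
    Prop :=
  exists ZL ZR : forall q, 'M[F]_(n q),
    (forall q, ZL q \in unitmx /\ ZR q \in unitmx) /\
    (forall q,
      [/\ lssE S' q = ZL q *m lssE S q *m ZR q,
          lssA S' q = ZL q *m lssA S q *m ZR q,
          lssB S' q = ZL q *m lssB S q,
          lssC S' q = lssC S q *m ZR q
        & lssK S' q = ZL (other q) *m lssK S q *m ZR q]).

Definition pencil_eigenvalue (F : fieldType) (n : nat) (A E : 'M[F]_n)
  (s : F) : Prop := \det (s *: E - A) = 0.

(** A family of groups of interpolation points.  Group [i] consists of the
    points [pt i t] with [1 <= t <= 2 * mult i]; values of [pt i] at other
    subscripts are irrelevant. *)
Record interp_points (F : Type) (k : nat) := InterpPoints {
  groups : nat;
  mult : 'I_groups -> nat;
  pt : 'I_groups -> nat -> F;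
  mult_gt0 : forall i, (0 < mult i)%N;
  mult_sum : (\sum_(i < groups) mult i)%N = k
}.

Arguments mult {F k} _ _.
Arguments pt {F k} _ _ _.

(** Below, positions [g], [h] inside a group are counted from 0, whereas the
    subscripts of the points start from 1: position [g] of mode 1 (resp. 2)
    uses the subscript 2g+1 (resp. 2g+2). *)
Definition sub (q : mode) (g : nat) : nat :=
  if q is M1 then g.*2.+1 else g.*2.+2.

Definition mode_of_sub (t : nat) : mode := if odd t then M1 else M2.

Fixpoint right_tuple (F : Type) (x : nat -> F) (q : mode) (g : nat) : seq F :=
  if g is g'.+1 then x (sub q g) :: right_tuple x (other q) g'
  else [:: x (sub q 0)].

Fixpoint left_tuple (F : Type) (x : nat -> F) (q : mode) (h : nat) : seq F :=
  if h is h'.+1 then rcons (left_tuple x (other q) h') (x (sub q h))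
  else [:: x (sub q 0)].

(** The alternating words of length [g] starting, resp. ending, with [q]. *)
Definition word_from (q : mode) (g : nat) : seq mode := traject other q g.
Definition word_to (q : mode) (g : nat) : seq mode := rev (traject other q g).

Section Realization.
Variables (F : fieldType) (n : mode -> nat) (S : lss F n).

Definition Phi (q : mode) (s : F) : 'M[F]_(n q) :=
  invmx (s *: lssE S q - lssA S q).

(** [K_q] regarded as a matrix from mode [q] to mode [p]; it is meaningful
    only if [p <> q], the other cases being set to 0. *)
Definition coupling (p q : mode) : 'M[F]_(n p, n q) :=
  match p, q with
  | M2, M1 => lssK S M1
  | M1, M2 => lssK S M2
  | _, _ => 0
  end.

Fixpoint transfer_state (q : mode) (s : F) (w : seq (mode * F)) :
    'cV[F]_(n q) :=
  if w is (q', s') :: w' then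
    Phi q s *m coupling q q' *m transfer_state q' s' w'
  else Phi q s *m lssB S q.

(** H_w(s); only relevant for nonempty [w] without equal consecutive symbols
    and [size s = size w]. *)
Definition transfer (w : seq mode) (s : seq F) : F :=
  if zip w s is (q, x) :: t then (lssC S q *m transfer_state q x t) 0 0
  else 0.

Fixpoint ctrl_col (x : nat -> F) (q : mode) (g : nat) : 'cV[F]_(n q) :=
  if g is g'.+1 then
    Phi q (x (sub q g)) *m coupling q (other q) *m ctrl_col x (other q) g'
  else Phi q (x (sub q 0)) *m lssB S q.

Fixpoint obs_row (x : nat -> F) (q : mode) (h : nat) : 'rV[F]_(n q) :=
  if h is h'.+1 then
    obs_row x (other q) h' *m coupling (other q) q *m Phi q (x (sub q h))
  else lssC S q *m Phi q (x (sub q 0)).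

Definition ctrl_block (x : nat -> F) (q : mode) (m : nat) : 'M[F]_(n q, m) :=
  \matrix_(a < n q, g < m) ctrl_col x q g a 0.

Definition obs_block (x : nat -> F) (q : mode) (p : nat) : 'M[F]_(p, n q) :=
  \matrix_(h < p, a < n q) obs_row x q h 0 a.

Definition ctrl_mx (k : nat) (lam : interp_points F k) (q : mode) :
    'M[F]_(n q, k) :=
  castmx (erefl (n q), mult_sum lam)
    (\mxrow_(i < groups lam) ctrl_block (pt lam i) q (mult lam i)).

Definition obs_mx (l : nat) (mu : interp_points F l) (q : mode) :
    'M[F]_(l, n q) :=
  castmx (mult_sum mu, erefl (n q))
    (\mxcol_(j < groups mu) obs_block (pt mu j) q (mult mu j)).

Section Loewner.
Variables (k l : nat) (lam : interp_points F k) (mu : interp_points F l).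

Definition loewner (q : mode) : 'M[F]_(l, k) :=
  - (obs_mx mu q *m lssE S q *m ctrl_mx lam q).

Definition shifted_loewner (q : mode) : 'M[F]_(l, k) :=
  - (obs_mx mu q *m lssA S q *m ctrl_mx lam q).

Definition dataW (q : mode) : 'rV[F]_k := lssC S q *m ctrl_mx lam q.

Definition dataV (q : mode) : 'cV[F]_l := obs_mx mu q *m lssB S q.

Definition dataXi (q : mode) : 'M[F]_(l, k) :=
  obs_mx mu (other q) *m lssK S q *m ctrl_mx lam q.

End Loewner.

Definition loewner_lss (k : nat) (lam mu : interp_points F k) :
    lss F (fun=> k) :=
  @Lss F (fun=> k)
    (fun q => - loewner lam mu q) (fun q => - shifted_loewner lam mu q)
    (dataV mu) (dataW lam) (dataXi lam mu).

End Realization.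

Definition matches_data (F : fieldType) (n n' : mode -> nat)
    (S : lss F n) (S' : lss F n') (k l : nat)
    (lam : interp_points F k) (mu : interp_points F l) : Prop :=
  [/\ forall (j : 'I_(groups mu)) (h : 'I_(mult mu j)) (a : mode),
        let w := word_to a h.+1 in
        let s := left_tuple (pt mu j) a h in
        transfer S w s = transfer S' w s,
      forall (i : 'I_(groups lam)) (g : 'I_(mult lam i)) (a : mode),
        let w := word_from a g.+1 in
        let s := right_tuple (pt lam i) a g in
        transfer S w s = transfer S' w s
    & forall (j : 'I_(groups mu)) (h : 'I_(mult mu j))
             (i : 'I_(groups lam)) (g : 'I_(mult lam i)) (a : mode),
        let b := other a in
        let w := word_to a h.+1 ++ word_from b g.+1 in
        let s := left_tuple (pt mu j) a h ++ right_tuple (pt lam i) b g in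
        transfer S w s = transfer S' w s].

(* Main.v *)
Require Import Defs.
From mathcomp Require Import all_boot all_order all_algebra.
From mathcomp Require Import reals.
From mathcomp.real_closed Require Import complex.

Set Implicit Arguments.
Unset Strict Implicit.
Unset Printing Implicit Defensive.

Import GRing.Theory.
Local Open Scope ring_scope.

(** The Loewner realization is the Petrov-Galerkin projection of [S] by the
    observability matrices [O q] on the left and the controllability matrices
    [R q] on the right.  Since the states of [S] generated by the right tuples
    lie in the column span of [R q], the regularity of the projected pencil
    forces [R q] to map the states of the projection exactly to those of [S],
    and dually for [O q]; every data value is a product of such a row and such a
    column.  When [n q = k], invertibility of [O q *m E q *m R q] makes [O q] and
    [R q] invertible, and their inverses give the equivalence. *)

Lemma mode_of_subK (q : mode) (g : nat) : mode_of_sub (sub q g) = q.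
Proof. by case: q; rewrite /mode_of_sub /= odd_double. Qed.

Lemma sub_bounds (q : mode) (g m : nat) :
  (g < m)%N -> (1 <= sub q g <= 2 * m)%N.
Proof.
by move=> lt_gm; rewrite mul2n; case: q; rewrite /= ?ltn_double ?ltn_Sdouble.
Qed.

Lemma unitmx_opp (F : fieldType) (n : nat) (A : 'M[F]_n) :
  (- A \in unitmx) = (A \in unitmx).
Proof. by rewrite -scaleN1r unitmxZ ?unitrN1. Qed.

Lemma pencil_unitP (F : fieldType) (n : nat) (A E : 'M[F]_n) (s : F) :
  ~ pencil_eigenvalue A E s -> s *: E - A \in unitmx.
Proof. by move=> neq0; rewrite unitmxE unitfE; apply/eqP. Qed.

Lemma col_mxrow_span (F : fieldType) (n k r : nat) (m : 'I_r -> nat)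
    (B : forall i, 'M[F]_(n, m i)) (e : (\sum_(i < r) m i)%N = k)
    (i : 'I_r) (g : 'I_(m i)) :
  exists v : 'cV[F]_k,
    castmx (erefl n, e) (\mxrow_(i < r) B i) *m v = col g (B i).
Proof.
case: _ / e; rewrite castmx_id.
(* [tagnat.Rank _ g] is the position, in the concatenated matrix, of column [g] of block [i]; the
   witness is the matching standard basis vector. *)
exists (delta_mx (tagnat.Rank _ g) 0); rewrite -colE.
by rewrite -[in RHS](mxrowK B i); apply/colP => a; rewrite !mxE.
Qed.

Lemma row_mxcol_span (F : fieldType) (n k r : nat) (m : 'I_r -> nat)
    (B : forall i, 'M[F]_(m i, n)) (e : (\sum_(i < r) m i)%N = k)
    (i : 'I_r) (g : 'I_(m i)) :
  exists v : 'rV[F]_k,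
    v *m castmx (e, erefl n) (\mxcol_(i < r) B i) = row g (B i).
Proof.
case: _ / e; rewrite castmx_id.
exists (delta_mx 0 (tagnat.Rank _ g)); rewrite -rowE.
by rewrite -[in RHS](mxcolK B i); apply/rowP => a; rewrite !mxE.
Qed.

(** If [R *m v] solves the full system, then [b = P *m R *m v], so [L *m b = (L *m P *m R) *m v]:
    the projected solve recovers [v] itself, whatever [L] is. *)
Lemma projected_solve_col (F : fieldType) (n k : nat) (P : 'M[F]_n)
    (L : 'M[F]_(k, n)) (R : 'M[F]_(n, k)) (b : 'cV[F]_n) :
  P \in unitmx -> L *m P *m R \in unitmx ->
  (exists v, R *m v = invmx P *m b) ->
  R *m (invmx (L *m P *m R) *m (L *m b)) = invmx P *m b.
Proof.
move=> uP uPR [v Rv]; rewrite -[in LHS](mulKVmx uP b) -Rv.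
by congr (R *m _); rewrite -[RHS](mulKmx uPR) !mulmxA.
Qed.

Lemma projected_solve_row (F : fieldType) (n k : nat) (P : 'M[F]_n)
    (L : 'M[F]_(k, n)) (R : 'M[F]_(n, k)) (c : 'rV[F]_n) :
  P \in unitmx -> L *m P *m R \in unitmx ->
  (exists v, v *m L = c *m invmx P) ->
  c *m R *m invmx (L *m P *m R) *m L = c *m invmx P.
Proof.
move=> uP uPR [v vL]; rewrite -[in LHS](mulmxKV uP c) -vL.
by congr (_ *m L); rewrite -[RHS](mulmxK uPR) !mulmxA.
Qed.

(** Since [n q = k] is only a propositional equality, the inner dimensions are cast so that all
    factors become square of size [k]. *)
Lemma mulmx_castmx (F : fieldType) (m n n' p q q' : nat) (en : n = n')
    (eq : q = q') (A : 'M[F]_(m, n)) (B : 'M[F]_(n, q)) (C : 'M[F]_(q, p)) :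
  A *m B *m C = castmx (erefl m, en) A *m castmx (en, eq) B *m
                castmx (eq, erefl p) C.
Proof. by case: _ / en; case: _ / eq; rewrite !castmx_id. Qed.

Section TransferFactorization.
Variables (F : fieldType) (n : mode -> nat) (S : lss F n).

(* What the tail [t] of a word feeds into the resolvent [Phi S q s] of the
   letter preceding it. *)
Definition entry (q : mode) (t : seq (mode * F)) : 'cV[F]_(n q) :=
  if t is (q', s) :: t' then coupling S q q' *m transfer_state S q' s t'
  else lssB S q.

Lemma transfer_stateE q s t : transfer_state S q s t = Phi S q s *m entry q t.
Proof. by case: t => [|[q' s'] t] //=; rewrite mulmxA. Qed.

(** [transfer] branches on the zipped list, so the head is exposed here together with the state that
    its tail produces. *)
Lemma zip_right_tuple (x : nat -> F) q g :
  exists2 t, zip (word_from q g.+1) (right_tuple x q g) = (q, x (sub q g)) :: t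
    & transfer_state S q (x (sub q g)) t = ctrl_col S x q g.
Proof.
elim: g q => [|g IHg] q; first by exists [::].
have [t zipE stE] := IHg (other q).
exists ((other q, x (sub (other q) g)) :: t).
  by rewrite -zipE.
by rewrite /= stE.
Qed.

Lemma transfer_right (x : nat -> F) q g :
  transfer S (word_from q g.+1) (right_tuple x q g) =
  (lssC S q *m ctrl_col S x q g) 0 0.
Proof. by rewrite /transfer; have [t -> ->] := zip_right_tuple x q g. Qed.

(** Left tuples grow at their end while [transfer_state] recurses from the front. With an arbitrary
    continuation, the induction can move the last letter of the left word into [w]. *)
Lemma transfer_left_cat (x : nat -> F) q h w s :
  transfer S (word_to q h.+1 ++ w) (left_tuple x q h ++ s) =
  (obs_row S x q h *m entry q (zip w s)) 0 0.
Proof.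
elim: h q w s => [|h IHh] q w s.
  by rewrite /transfer /= transfer_stateE mulmxA.
rewrite /word_to trajectS rev_cons /= !cat_rcons IHh /=.
by rewrite transfer_stateE !mulmxA.
Qed.

Lemma transfer_left (x : nat -> F) q h :
  transfer S (word_to q h.+1) (left_tuple x q h) =
  (obs_row S x q h *m lssB S q) 0 0.
Proof. by have := transfer_left_cat x q h [::] [::]; rewrite !cats0. Qed.

Lemma transfer_left_right (x y : nat -> F) a h b g :
  transfer S (word_to a h.+1 ++ word_from b g.+1)
    (left_tuple x a h ++ right_tuple y b g) =
  (obs_row S x a h *m coupling S a b *m ctrl_col S y b g) 0 0.
Proof.
rewrite transfer_left_cat; have [t -> /= ->] := zip_right_tuple y b g.
by rewrite mulmxA.
Qed.

End TransferFactorization.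

Section LoewnerProjection.
Variables (F : fieldType) (n : mode -> nat) (S : lss F n).
Variables (k : nat) (lam mu : interp_points F k).

Local Notation S' := (loewner_lss S lam mu).

Lemma ctrl_mx_span (i : 'I_(groups lam)) (g : 'I_(mult lam i)) q :
  exists v, ctrl_mx S lam q *m v = ctrl_col S (pt lam i) q g.
Proof.
have [v vE] := col_mxrow_span
  (fun i => ctrl_block S (pt lam i) q (mult lam i)) (mult_sum lam) g.
by exists v; rewrite [LHS]vE; apply/colP => a; rewrite !mxE.
Qed.

Lemma obs_mx_span (j : 'I_(groups mu)) (h : 'I_(mult mu j)) q :
  exists v, v *m obs_mx S mu q = obs_row S (pt mu j) q h.
Proof.
have [v vE] := row_mxcol_span
  (fun j => obs_block S (pt mu j) q (mult mu j)) (mult_sum mu) h.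
by exists v; rewrite [LHS]vE; apply/rowP => a; rewrite !mxE.
Qed.

Lemma loewner_pencilE q s :
  s *: lssE S' q - lssA S' q =
  obs_mx S mu q *m (s *: lssE S q - lssA S q) *m ctrl_mx S lam q.
Proof.
by rewrite /= !opprK mulmxBr mulmxBl -scalemxAr -scalemxAl.
Qed.

Lemma PhiE q s :
  Phi S' q s = invmx (obs_mx S mu q *m (s *: lssE S q - lssA S q) *m
                      ctrl_mx S lam q).
Proof. by rewrite /Phi loewner_pencilE. Qed.

Definition regular_at (q : mode) (s : F) :=
  s *: lssE S q - lssA S q \in unitmx /\
  obs_mx S mu q *m (s *: lssE S q - lssA S q) *m ctrl_mx S lam q \in unitmx.

Lemma regular_atP q s :
  ~ pencil_eigenvalue (lssA S q) (lssE S q) s ->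
  ~ pencil_eigenvalue (shifted_loewner S lam mu q) (loewner S lam mu q) s ->
  regular_at q s.
Proof.
move=> /pencil_unitP uP /pencil_unitP uL; split=> //.
(* The pencil of [S'] is the negative of the Loewner pencil, so both are regular at the same
   points. *)
by rewrite -loewner_pencilE -unitmx_opp /= scalerN opprK opprD opprK.
Qed.

Lemma loewner_coupling p q :
  coupling S' p q = obs_mx S mu p *m coupling S p q *m ctrl_mx S lam q.
Proof. by case: p; case: q; rewrite //= mulmx0 mul0mx. Qed.

(** By induction on [g], the projected right-hand side is [obs_mx] applied to the true one, so
    [projected_solve_col] applies. Regularity is needed in both modes because they alternate along
    the recursion. *)
Lemma ctrl_mx_ctrl_col (i : 'I_(groups lam)) :
  (forall q g, (g < mult lam i)%N -> regular_at q (pt lam i (sub q g))) ->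
  forall q g, (g < mult lam i)%N ->
  ctrl_mx S lam q *m ctrl_col S' (pt lam i) q g = ctrl_col S (pt lam i) q g.
Proof.
move=> reg q g; elim: g q => [|g IHg] q lt_g.
  have [uP uPR] := reg q _ lt_g; rewrite [ctrl_col S' _ _ _]/= PhiE.
  by apply: projected_solve_col => //; apply: (ctrl_mx_span (Ordinal lt_g)).
have [uP uPR] := reg q _ lt_g.
rewrite [ctrl_col S' _ _ _]/= PhiE loewner_coupling -!mulmxA.
rewrite (IHg _ (ltnW lt_g)) [RHS]/= -[RHS]mulmxA.
(* Restores the bracketing of the projected pencil inside the inverse. *)
rewrite [obs_mx S mu q *m (_ *m (ctrl_mx S lam q))]mulmxA.
apply: projected_solve_col => //.
have [v vE] := ctrl_mx_span (Ordinal lt_g) q.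
by exists v; rewrite vE /= mulmxA.
Qed.

Lemma obs_row_obs_mx (j : 'I_(groups mu)) :
  (forall q h, (h < mult mu j)%N -> regular_at q (pt mu j (sub q h))) ->
  forall q h, (h < mult mu j)%N ->
  obs_row S' (pt mu j) q h *m obs_mx S mu q = obs_row S (pt mu j) q h.
Proof.
move=> reg q h; elim: h q => [|h IHh] q lt_h.
  have [uP uPR] := reg q _ lt_h; rewrite [obs_row S' _ _ _]/= PhiE.
  by apply: projected_solve_row => //; apply: (obs_mx_span (Ordinal lt_h)).
have [uP uPR] := reg q _ lt_h.
rewrite [obs_row S' _ _ _]/= PhiE loewner_coupling !mulmxA.
rewrite (IHh _ (ltnW lt_h)).
by apply: projected_solve_row => //; apply: (obs_mx_span (Ordinal lt_h)).
Qed.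

Lemma loewner_matches_data :
  (forall i q g, (g < mult lam i)%N -> regular_at q (pt lam i (sub q g))) ->
  (forall j q h, (h < mult mu j)%N -> regular_at q (pt mu j (sub q h))) ->
  matches_data S S' lam mu.
Proof.
move=> reg_lam reg_mu.
split=> [j h a | i g a | j h i g a] /=.
- rewrite !transfer_left -(obs_row_obs_mx (reg_mu j)) ?ltn_ord //.
  by rewrite -mulmxA.
- rewrite !transfer_right -(ctrl_mx_ctrl_col (reg_lam i)) ?ltn_ord //.
  by rewrite mulmxA.
(* The coupling of [S'] carries [obs_mx] on its left and [ctrl_mx] on its right, which turn the
   adjacent row and column of [S'] into those of [S]. *)
rewrite !transfer_left_right loewner_coupling.
rewrite -(obs_row_obs_mx (reg_mu j)) ?ltn_ord //.
by rewrite -(ctrl_mx_ctrl_col (reg_lam i)) ?ltn_ord // !mulmxA.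
Qed.

Lemma loewner_equiv (e : forall q, n q = k) :
  (forall q, loewner S lam mu q \in unitmx) ->
  lss_equiv S' (cast_lss (n' := fun=> k) e S).
Proof.
move=> uL.
pose O q := castmx (erefl k, e q) (obs_mx S mu q).
pose R q := castmx (e q, erefl k) (ctrl_mx S lam q).
have uOR q : O q \in unitmx /\ R q \in unitmx.
  have := uL q; rewrite unitmx_opp (mulmx_castmx (e q) (e q)) -!/(O _) -!/(R _).
  by rewrite !unitmx_mul -andbA => /and3P[].
exists (fun q => invmx (O q)), (fun q => invmx (R q)); split=> q.
  by rewrite !unitmx_inv; apply: uOR.
have [uO uR] := uOR q; have [uO' _] := uOR (other q).
split; rewrite /= ?opprK.
- by rewrite (mulmx_castmx (e q) (e q)) -!mulmxA mulmxV ?mulmx1 ?mulKmx.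
- by rewrite (mulmx_castmx (e q) (e q)) -!mulmxA mulmxV ?mulmx1 ?mulKmx.
(* The factor [1%:M] pads a product of two matrices to the three-factor shape of [mulmx_castmx]. *)
- have := mulmx_castmx (e q) (erefl 1%N) (obs_mx S mu q) (lssB S q) 1%:M.
  by rewrite castmx_id !mulmx1 /dataV => ->; rewrite mulKmx.
- have := mulmx_castmx (erefl 1%N) (e q) 1%:M (lssC S q) (ctrl_mx S lam q).
  by rewrite castmx_id !mul1mx /dataW => ->; rewrite mulmxK.
rewrite /dataXi (mulmx_castmx (e (other q)) (e q)) -!mulmxA mulmxV ?mulmx1 //.
by rewrite mulKmx.
Qed.

End LoewnerProjection.

Theorem lemma4p4 (R : realType) (n : mode -> nat) (S : lss R n)
  (k : nat) (lam mu : interp_points R[i] k)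
  (lam_reg : forall (i : 'I_(groups lam)) (t : nat),
     (1 <= t <= 2 * mult lam i)%N ->
     ~ pencil_eigenvalue (lssA (complexify S) (mode_of_sub t))
         (lssE (complexify S) (mode_of_sub t)) (pt lam i t))
  (mu_reg : forall (j : 'I_(groups mu)) (t : nat),
     (1 <= t <= 2 * mult mu j)%N ->
     ~ pencil_eigenvalue (lssA (complexify S) (mode_of_sub t))
         (lssE (complexify S) (mode_of_sub t)) (pt mu j t))
  (lam_loewner : forall (i : 'I_(groups lam)) (t : nat) (q : mode),
     (1 <= t <= 2 * mult lam i)%N ->
     ~ pencil_eigenvalue (shifted_loewner (complexify S) lam mu q)
         (loewner (complexify S) lam mu q) (pt lam i t))
  (mu_loewner : forall (j : 'I_(groups mu)) (t : nat) (q : mode),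
     (1 <= t <= 2 * mult mu j)%N ->
     ~ pencil_eigenvalue (shifted_loewner (complexify S) lam mu q)
         (loewner (complexify S) lam mu q) (pt mu j t))
  (loewner_unit : forall q : mode,
     loewner (complexify S) lam mu q \in unitmx) :
  matches_data (complexify S) (loewner_lss (complexify S) lam mu) lam mu /\
  (forall e : (forall q : mode, n q = k),
     lss_equiv (loewner_lss (complexify S) lam mu)
       (cast_lss (n' := fun=> k) e (complexify S))).
Proof.
have reg_lam i q g : (g < mult lam i)%N ->
    regular_at (complexify S) lam mu q (pt lam i (sub q g)).
  move=> /(sub_bounds q) bounds; apply: regular_atP; last exact: lam_loewner.
  by have := lam_reg i _ bounds; rewrite mode_of_subK.
have reg_mu j q h : (h < mult mu j)%N ->
    regular_at (complexify S) lam mu q (pt mu j (sub q h)).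
  move=> /(sub_bounds q) bounds; apply: regular_atP; last exact: mu_loewner.
  by have := mu_reg j _ bounds; rewrite mode_of_subK.
split; first exact: loewner_matches_data.
by move=> e; apply: loewner_equiv.
Qed.
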